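(* Let $\overline m<\overline m'$ be maximum memory lengths. For GP-ASSMs (as defined in the context) with states $\bm x_t^m$ (memory $\overline m$) and $\bm x_t^{m'}$ (memory $\overline m'$), built from the same training data, kernel and mean function, with the same input sequence and the same initial state $\bm x_0^m=\bm x_0^{m'}\in\mathbb{R}^{n_x}$, the implication $$\sup_{t\in\mathbb{N}}\mathbb E\|\bm x_t^m\|^p<\infty\ \Longrightarrow\ \sup_{t\in\mathbb{N}}\mathbb E\|\bm x_t^{m'}\|^p<\infty$$ does not hold in general, for any $p\in\mathbb{N}$; that is, boundedness of the $p$-th moments of the GP-ASSM with memory $\overline m$ does not imply boundedness of the $p$-th moments of the GP-ASSM with the longer memory $\overline m'$.
   Context: Training set $\mathcal D=\{X,Y\}$ with input matrix $X\in\mathbb{R}^{n_\xi\times n_{\mathcal D}}$ and output matrix $Y\in\mathbb{R}^{n_{\mathcal D}\times n_x}$, outputs corrupted by Gaussian noise $\mathcal N(0,\sigma_n^2 I)$. A kernel $k:\mathbb{R}^{n_\xi}\times\mathbb{R}^{n_\xi}\to\mathbb{R}$ (symmetric, positive semidefinite, not necessarily bounded) and a continuous mean function $m:\mathbb{R}^{n_\xi}\to\mathbb{R}$ are used for every output dimension. For matrices $A=[a_1,\dots,a_p]$, $B=[b_1,\dots,b_q]$ with columns in $\mathbb{R}^{n_\xi}$, $K(A,B)$ is the $p\times q$ matrix with entries $k(a_i,b_j)$, $\bm k(z,A)=(k(z,a_1),\dots,k(z,a_p))^\top$, $\bm m(A)=(m(a_1),\dots,m(a_p))^\top$, and $K:=K(X,X)$.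 GP-ASSM with maximum memory length $\overline m\in\mathbb{N}\cup\{\infty\}$: states $\bm x_t\in\mathbb{R}^{n_x}$, inputs $\bm u_t\in\mathbb{R}^{n_u}$, $\bm\xi_t=[\bm x_t;\bm u_t]\in\mathbb{R}^{n_\xi}$, $n_\xi=n_x+n_u$. For $t\in\mathbb{N}$ let $\underline m=\min(t,\overline m)$, memory $\Xi^m_t=[\bm\xi_{t-1},\dots,\bm\xi_{t-\underline m}]$ (empty if $\underline m=0$), $X^m_t=[X,\bm\xi_{t-\underline m},\dots,\bm\xi_{t-1}]$, $Y^m_t=[Y^\top,\bm x_{t-\underline m+1},\dots,\bm x_t]^\top$, and with $\Xi=[\bm\xi_{t-\underline m},\dots,\bm\xi_{t-1}]$, $K^m_t=\begin{bmatrix}K+\sigma_n^2I & K(X,\Xi)\\ K(\Xi,X)&K(\Xi,\Xi)\end{bmatrix}$ (and $K^m_t=K+\sigma_n^2 I$ if $\underline m=0$). Define $\bm f_t(\bm\xi_t,\Xi^m_t)\in\mathbb{R}^{n_x}$ with $i$-th component $m(\bm\xi_t)+\bm k(\bm\xi_t,X^m_t)^\top(K^m_t)^{-1}\big((Y^m_t)_{:,i}-\bm m(X^m_t)\big)$ and the diagonal matrix $F_t(\bm\xi_t,\Xi^m_t)$ with all diagonal entries $k(\bm\xi_t,\bm\xi_t)-\bm k(\bm\xi_t,X^m_t)^\top(K^m_t)^{-1}\bm k(\bm\xi_t,X^m_t)$ (inverses are Moore–Penrose pseudoinverses if singular). The GP-ASSM is the stochastic process obtained by sequentially sampling $\bm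 x^m_{t+1}\mid\bm\xi_{0:t}\sim\mathcal N(\bm f_t(\bm\xi_t,\Xi^m_t),F_t(\bm\xi_t,\Xi^m_t))$; the process with $\overline m'$ is defined in the same way along its own trajectory $\bm\xi'_t=[\bm x^{m'}_t;\bm u_t]$. *)

(* Defs.v *)
From mathcomp Require Import all_boot all_order all_algebra.
From mathcomp Require Import all_classical all_reals all_analysis.
From mathcomp Require Import normal_distribution.

Set Implicit Arguments.
Unset Strict Implicit.
Unset Printing Implicit Defensive.

Import Order.TTheory GRing.Theory Num.Theory.
Import numFieldNormedType.Exports.
Local Open Scope classical_set_scope.
Local Open Scope ring_scope.

Section GPASSM.
Variable R : realType.

(* Maximum memory length in N u {oo}: [None] stands for oo. *)
Definition memlen := option nat.

Definition mem_lt (a b : memlen) : Prop :=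
  match a, b with
  | Some a, Some b => (a < b)%N
  | Some _, None => True
  | None, _ => False
  end.

Definition mem_eff (mbar : memlen) (t : nat) : nat :=
  match mbar with None => t | Some m => minn t m end.

(* Moore--Penrose pseudoinverse (defined via the four Penrose equations;
   it exists and is unique for real matrices, and equals the inverse when
   the matrix is invertible). *)
Definition penrose n (A B : 'M[R]_n) : Prop :=
  [/\ A *m B *m A = A, B *m A *m B = B,
      (A *m B)^T = A *m B & (B *m A)^T = B *m A].

Definition mp_pinv n (A : 'M[R]_n) : 'M[R]_n := xget 0 [set B | penrose A B].

Definition psd_kernel d (k : 'cV[R]_d -> 'cV[R]_d -> R) : Prop :=
  (forall a b, k a b = k b a) /\
  (forall (N : nat) (a : 'I_N -> 'cV[R]_d) (c : 'I_N -> R),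
     0 <= \sum_(i < N) \sum_(j < N) c i * c j * k (a i) (a j)).

Variables (nx nu nD : nat).
Local Notation nxi := (nx + nu)%N.

(* Data of a GP-ASSM: training inputs X (columns), training outputs Y,
   noise variance sn2 = sigma_n^2, kernel k, mean function mu, and
   the input sequence u. *)
Variables (X : 'M[R]_(nxi, nD)) (Y : 'M[R]_(nD, nx)) (sn2 : R)
  (k : 'cV[R]_nxi -> 'cV[R]_nxi -> R) (mu : 'cV[R]_nxi -> R)
  (u : nat -> 'cV[R]_nu).

Definition gram p q (A : 'M[R]_(nxi, p)) (B : 'M[R]_(nxi, q)) : 'M[R]_(p, q) :=
  \matrix_(i, j) k (col i A) (col j B).

Definition kvec p (z : 'cV[R]_nxi) (A : 'M[R]_(nxi, p)) : 'cV[R]_p :=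
  \col_i k z (col i A).

Definition mvec p (A : 'M[R]_(nxi, p)) : 'cV[R]_p := \col_i mu (col i A).

Definition xi_of (xs : nat -> 'cV[R]_nx) (s : nat) : 'cV[R]_nxi :=
  col_mx (xs s) (u s).

Section Step.
Variables (mbar : memlen) (t : nat) (xs : nat -> 'cV[R]_nx).
Local Notation m_ := (mem_eff mbar t).

Definition Xi : 'M[R]_(nxi, m_) := \matrix_(i, j) xi_of xs (t - m_ + j)%N i 0.
Definition Xm : 'M[R]_(nxi, nD + m_) := row_mx X Xi.
Definition Ym : 'M[R]_(nD + m_, nx) :=
  col_mx Y (\matrix_(j, i) xs (t - m_ + j).+1 i 0).
Definition Km : 'M[R]_(nD + m_) :=
  block_mx (gram X X + sn2%:M) (gram X Xi) (gram Xi X) (gram Xi Xi).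

Definition gp_mean : 'cV[R]_nx :=
  \col_i (mu (xi_of xs t)
          + ((kvec (xi_of xs t) Xm)^T *m mp_pinv Km
              *m (col i Ym - mvec Xm)) 0 0).

(* common diagonal entry of F_t(xi_t, Xi^m_t) *)
Definition gp_var : R :=
  k (xi_of xs t) (xi_of xs t)
  - ((kvec (xi_of xs t) Xm)^T *m mp_pinv Km *m kvec (xi_of xs t) Xm) 0 0.
End Step.

(* Sequential sampling x_{t+1} ~ N(f_t, F_t), F_t = v_t I, realized as
   x_{t+1} = f_t + sqrt(v_t) * z_t with z_t a vector of nx independent
   standard normal variables; the noise coordinates are w (t * nx + i). *)
Fixpoint traj (mbar : memlen) (x0 : 'cV[R]_nx) (w : nat -> R) (t : nat)
  : seq 'cV[R]_nx :=
  match t with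
  | 0 => [:: x0]
  | t'.+1 =>
      let h := traj mbar x0 w t' in
      let xs := fun s => nth x0 h s in
      rcons h (gp_mean mbar t' xs
               + Num.sqrt (gp_var mbar t' xs) *: \col_(i < nx) w (t' * nx + i)%N)
  end.

Definition state (mbar : memlen) (x0 : 'cV[R]_nx) (w : nat -> R) (t : nat)
  : 'cV[R]_nx := nth x0 (traj mbar x0 w t) t.

(* Expectation of a nonnegative functional of N i.i.d. standard normal
   variables w 0, ..., w (N-1) (iterated integral). *)
Fixpoint gauss_exp (N : nat) (g : (nat -> R) -> \bar R) : \bar R :=
  match N with
  | 0 => g (fun _ => 0)
  | N'.+1 => (\int[normal_prob 0 1]_(a in [set: R])
                gauss_exp N' (fun w => g (fun i => if i == N' then a else w i)))%E
  end.

Definition eucl_norm n (v : 'cV[R]_n) : R := Num.sqrt (\sum_i v i 0 ^+ 2).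

Definition moment (mbar : memlen) (x0 : 'cV[R]_nx) (p t : nat) : \bar R :=
  gauss_exp (t * nx) (fun w => ((eucl_norm (state mbar x0 w t)) ^+ p)%:E).

Definition moments_bounded (mbar : memlen) (x0 : 'cV[R]_nx) (p : nat) : Prop :=
  (ereal_sup (range (moment mbar x0 p)) < +oo)%E.

End GPASSM.

(* Main.v *)
Require Import Defs.
From mathcomp Require Import all_boot all_order all_algebra.
From mathcomp Require Import all_classical all_reals all_analysis.
From mathcomp Require Import measurable_realfun normal_distribution ring lra zify.

Import Order.TTheory GRing.Theory Num.Theory.
Import numFieldNormedType.Exports.
Local Open Scope classical_set_scope.
Local Open Scope ring_scope.

(* There is no training data, and the kernel gain(a) gain(b) has rank one, so the
   Gaussian process is one standard normal variable times the gain. At time 0 the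
   gain is 1 and this variable is revealed as x_1 = w_0; the mean function then
   copies the state until time m + 1, where the gain is psi(x) = psi(w_0).
   A memory of length m has by then lost time 0, so a fresh variable is drawn and
   x_{m+2} = psi(w_0) w_{m+1}. A longer memory still contains time 0 and reproduces
   the old variable, so x_{m+2} = psi(w_0) w_0. Afterwards the state is constant.
   With psi(x)^p = exp(x^2/2) / (1 + x^2), which turns the Gaussian density into a
   multiple of 1 / (1 + x^2), the p-th moment is finite in the first case and
   infinite in the second. *)

(** * Integrals against the standard normal law *)

Section GaussianIntegrals.
Context {R : realType}.
Local Notation leb := (@lebesgue_measure R).
Local Notation gauss := (@normal_prob R 0 1).
Implicit Types (x y : R) (f : R -> R).

Lemma ge0_integral_normal_prob f :
  measurable_fun [set: R] f -> (forall x, 0 <= f x) ->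
  (\int[gauss]_x (f x)%:E = \int[leb]_x (f x * normal_pdf 0 1 x)%:E)%E.
Proof.
move=> mf f0.
have dom : gauss `<< leb by exact: normal_prob_dominates.
rewrite -(Radon_Nikodym_SigmaFinite.change_of_variables dom)//; last first.
  exact/measurable_EFinP.
under [RHS]eq_integral do rewrite EFinM.
have mfE : measurable_fun [set: R] (fun x => (f x)%:E) by exact/measurable_EFinP.
have mpdf : measurable_fun [set: R] (fun x => (normal_pdf 0 1 x)%:E).
  by apply/measurable_EFinP; exact: measurable_normal_pdf.
have iRN := Radon_Nikodym_SigmaFinite.f_integrable dom.
apply: ae_eq_integral => //.
- exact: (emeasurable_funM mfE (measurable_int _ iRN)).
- exact: emeasurable_funM.
(* The Radon-Nikodym derivative is known only up to null sets; it agrees almost everywhere with the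
   density because both integrate to the measure of every measurable set. *)
- apply: ae_eqe_mul2l; apply: integral_ae_eq => // E _ mE.
  by rewrite -Radon_Nikodym_SigmaFinite.f_integral.
Qed.

Lemma std_normal_pdfE x :
  normal_pdf 0 1 x = normal_peak 1 * expR (- (x ^+ 2 / 2)) :> R.
Proof.
by rewrite normal_pdfE ?oner_neq0// /normal_fun subr0 expr1n mulNr.
Qed.

(** Two elementary bounds combine: [|x| / p <= expR (|x| / p)], raised to the power [p], and
    [|x| <= 1 + x ^+ 2 / 4], which is the square of [|x| / 2 - 1] being nonnegative. *)
Lemma normr_exprn_le_expR (p : nat) x :
  `|x| ^+ p <= p%:R ^+ p * (expR 1 * expR (x ^+ 2 / 4)).
Proof.
have le1 : expR `|x| <= expR 1 * expR (x ^+ 2 / 4).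
  rewrite -expRD ler_expR -(real_normK (num_real x)).
  by have := sqr_ge0 (`|x| / 2 - 1); lra.
case: p => [|p]; first by rewrite !expr0 mul1r (le_trans _ le1)// -expR0 ler_expR.
apply: (le_trans _ (ler_wpM2l _ le1)); last by rewrite exprn_ge0.
have -> : expR `|x| = expR (`|x| / p.+1%:R) ^+ p.+1.
  by rewrite -expRM_natl mulrC divfK ?pnatr_eq0.
rewrite -exprMn lerXn2r ?nnegrE// ?mulr_ge0 ?expR_ge0//.
rewrite mulrC -ler_pdivrMr ?ltr0n//.
by apply: le_trans (expR_ge1Dx _); rewrite lerDr.
Qed.

(* The factor exp (x^2 / 4) costs half of the Gaussian decay and leaves a multiple
   of the density of N(0, 2). *)
Lemma normal_abs_moment_lty (p : nat) :
  (\int[gauss]_x (`|x| ^+ p)%:E < +oo)%E.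
Proof.
have mX : measurable_fun [set: R] (fun x => `|x| ^+ p).
  by apply: measurable_funX; exact: normr_measurable.
rewrite ge0_integral_normal_prob//.
have s2 : (Num.sqrt 2 : R) ^+ 2 = 2 by rewrite sqr_sqrtr.
have s0 : (Num.sqrt 2 : R) != 0 by rewrite gt_eqF// sqrtr_gt0.
pose C : R := p%:R ^+ p * expR 1 * (normal_peak 1 / normal_peak (Num.sqrt 2)).
have C0 : 0 <= C.
  by rewrite !mulr_ge0 ?exprn_ge0 ?expR_ge0 ?invr_ge0 ?normal_peak_ge0.
have mpdf s : measurable_fun [set: R] (fun x => (normal_pdf 0 s x)%:E).
  by apply/measurable_EFinP; exact: measurable_normal_pdf.
apply: (@le_lt_trans _ _
    (\int[leb]_x (C%:E * (normal_pdf 0 (Num.sqrt 2) x)%:E)))%E.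
  apply: ge0_le_integral => //=.
  - by move=> x _; rewrite lee_fin mulr_ge0 ?exprn_ge0 ?normal_pdf_ge0.
  - by apply/measurable_EFinP/measurable_funM => //; exact: measurable_normal_pdf.
  - apply/measurable_EFinP/measurable_funM => //; exact: measurable_normal_pdf.
  move=> x _; rewrite -EFinM lee_fin std_normal_pdfE normal_pdfE//.
  rewrite /normal_fun subr0 s2.
  have -> : - x ^+ 2 / (2 *+ 2) = x ^+ 2 / 4 - x ^+ 2 / 2 by field.
  rewrite expRD /C.
  have alg (a b c d e h : R) : h != 0 ->
      a * b * (c / h) * (h * (d * e)) = a * (b * d) * (c * e).
    by move=> h0; field.
  rewrite alg; last by rewrite gt_eqF// normal_peak_gt0.
  by rewrite ler_wpM2r ?normr_exprn_le_expR// mulr_ge0 ?normal_peak_ge0 ?expR_ge0.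
rewrite ge0_integralZl_EFin//=.
  by rewrite integral_normal_pdf mule1 ltry.
by move=> x _; rewrite lee_fin normal_pdf_ge0.
exact: mpdf.
Qed.

(** Up to normalisation, the density of the Cauchy law relative to N(0, 1): finite mass, but no
    absolute moment of order 1 or more. *)
Definition cauchy_weight x : R := expR (x ^+ 2 / 2) / (1 + x ^+ 2).

Lemma cauchy_weight_ge0 x : 0 <= cauchy_weight x.
Proof. by rewrite divr_ge0 ?expR_ge0// addr_ge0 ?sqr_ge0. Qed.

Lemma continuous_invD1sqr : continuous (fun x => (1 + x ^+ 2)^-1).
Proof. exact: continuous_oneDsqrV. Qed.

Lemma measurable_invD1sqr : measurable_fun [set: R] (fun x => (1 + x ^+ 2)^-1).
Proof. by apply: continuous_measurable_fun; exact: continuous_invD1sqr. Qed.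

Lemma measurable_cauchy_weight : measurable_fun [set: R] cauchy_weight.
Proof.
apply: measurable_funM; last exact: measurable_invD1sqr.
by apply: measurableT_comp => //; apply: measurable_funM => //; exact: measurable_funX.
Qed.

Lemma cauchy_weight_pdf x :
  cauchy_weight x * normal_pdf 0 1 x = normal_peak 1 * (1 + x ^+ 2)^-1.
Proof.
rewrite std_normal_pdfE /cauchy_weight expRN.
have : expR (x ^+ 2 / 2) != 0 by rewrite gt_eqF ?expR_gt0.
have : 1 + x ^+ 2 != 0 by rewrite gt_eqF// ltr_wpDr ?sqr_ge0.
by move=> h1 h2; field; rewrite h1 h2.
Qed.

Lemma integral_cauchy_weight_lty : (\int[gauss]_x (cauchy_weight x)%:E < +oo)%E.
Proof.
rewrite ge0_integral_normal_prob; [|exact: measurable_cauchy_weight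
  |exact: cauchy_weight_ge0].
under eq_integral do rewrite cauchy_weight_pdf EFinM.
rewrite ge0_integralZl_EFin ?normal_peak_ge0//=; last 2 first.
- by move=> x _; rewrite lee_fin invr_ge0 addr_ge0 ?sqr_ge0.
- by apply/measurable_EFinP; exact: measurable_invD1sqr.
(* By evenness, the half-line suffices, where the integral is an arctangent. *)
rewrite (@ge0_symfun_integralT _ (fun x => (1 + x ^+ 2)^-1)).
- have := @integral0y_oneDsqr R; rewrite /oneDsqr set_itvcy => ->.
  by rewrite -!EFinM ltry.
- by move=> x; rewrite invr_ge0 addr_ge0 ?sqr_ge0.
- exact: continuous_invD1sqr.
- by move=> x /=; rewrite sqrrN.
Qed.

Lemma integral_itv1_inv (b : R) : 1 < b ->
  (\int[leb]_(x in `[1%R, b]) (x^-1)%:E = (ln b)%:E)%E.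
Proof.
move=> b1; rewrite (@continuous_FTC2 _ _ (@ln R))//.
- by rewrite ln1 sube0.
- apply: continuous_in_subspaceT => x; rewrite inE/= in_itv/= => /andP[x1 _].
  by apply: continuousV => //; rewrite gt_eqF// (lt_le_trans _ x1).
- split.
  + move=> x; rewrite in_itv/= => /andP[x1 _].
    by apply: ex_derive; apply: is_derive1_ln; exact: lt_trans x1.
  + by apply: cvg_at_right_filter; exact: continuous_ln.
  + by apply: cvg_at_left_filter; apply: continuous_ln; exact: lt_trans b1.
- move=> x; rewrite in_itv/= => /andP[x1 _]; rewrite derive1E.
  have x0 : 0 < x by exact: lt_trans x1.
  by have /@derive_val := is_derive1_ln x0.
Qed.

(** On [[1, b]] the Lebesgue integrand dominates [c / x], so the integral is at least [c * ln b],
    which is arbitrarily large. *)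
Lemma integral_cauchy_weight_moment (p : nat) : (1 <= p)%N ->
  (\int[gauss]_x (cauchy_weight x * `|x| ^+ p)%:E = +oo)%E.
Proof.
move=> p1.
have mw := measurable_cauchy_weight.
have mX : measurable_fun [set: R] (fun x => `|x| ^+ p).
  by apply: measurable_funX; exact: normr_measurable.
have w0 x : 0 <= cauchy_weight x * `|x| ^+ p.
  by rewrite mulr_ge0 ?cauchy_weight_ge0 ?exprn_ge0.
rewrite ge0_integral_normal_prob//; last exact: measurable_funM.
(* The factor 1/2 comes from [1 + x ^+ 2 <= 2 * x ^+ 2] for [x >= 1]. *)
pose c : R := normal_peak 1 / 2.
have c0 : 0 < c by rewrite divr_gt0// normal_peak_gt0 ?oner_neq0.
have mwX : measurable_fun [set: R]
    (fun x => (cauchy_weight x * `|x| ^+ p * normal_pdf 0 1 x)%:E).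
  apply/measurable_EFinP/measurable_funM; last exact: measurable_normal_pdf.
  exact: measurable_funM.
have wX0 x : (0 <= (cauchy_weight x * `|x| ^+ p * normal_pdf 0 1 x)%:E)%E.
  by rewrite lee_fin mulr_ge0 ?normal_pdf_ge0.
have lower (r : R) : 0 < r -> (r%:E <=
    \int[leb]_x (cauchy_weight x * `|x| ^+ p * normal_pdf 0 1 x)%:E)%E.
  (* Chosen so that [c * ln b = r]. *)
  move=> r0; pose b := expR (r / c).
  have b1 : 1 < b by rewrite -expR0 ltr_expR divr_gt0.
  have minv : measurable_fun `[1, b] (fun x : R => (x^-1)%:E).
    apply/measurable_EFinP; apply: subspace_continuous_measurable_fun => //.
    apply: continuous_in_subspaceT => x; rewrite inE/= in_itv/= => /andP[x1 _].
    by apply: continuousV => //; rewrite gt_eqF// (lt_le_trans _ x1).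
  apply: (@le_trans _ _ (\int[leb]_(x in `[1%R, b]) (c%:E * (x^-1)%:E)))%E.
    rewrite ge0_integralZl_EFin ?(ltW c0)//=.
      by rewrite integral_itv1_inv// /b expRK -EFinM mulrC divfK// gt_eqF.
    move=> x; rewrite in_itv/= => /andP[x1 _].
    by rewrite lee_fin invr_ge0 (le_trans ler01).
  apply: (@le_trans _ _ (\int[leb]_(x in `[1%R, b])
      (cauchy_weight x * `|x| ^+ p * normal_pdf 0 1 x)%:E))%E; last first.
    by apply: ge0_subset_integral.
  apply: ge0_le_integral => //=.
  - move=> x; rewrite in_itv/= => /andP[x1 _].
    by rewrite lee_fin mulr_ge0 ?(ltW c0)// invr_ge0 (le_trans ler01).
  - exact: measurable_funeM.
  - exact: measurable_funTS.
  move=> x; rewrite in_itv/= => /andP[x1 _].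
  rewrite -EFinM lee_fin (mulrAC (cauchy_weight x)) cauchy_weight_pdf /c -!mulrA.
  rewrite ler_wpM2l ?normal_peak_ge0//.
  have x0 : 0 < x by exact: lt_le_trans x1.
  (* Since [x >= 1] and [p >= 1], the power [|x| ^+ p] is at least [x]. *)
  rewrite (@le_trans _ _ ((1 + x ^+ 2)^-1 * x))//; last first.
    rewrite ler_wpM2l ?invr_ge0 ?addr_ge0 ?sqr_ge0// ger0_norm ?(ltW x0)//.
    by rewrite -{1}(expr1 x) ler_weXn2l.
  rewrite -invfM [leRHS]mulrC ler_pdivlMr ?ltr_wpDr ?sqr_ge0//.
  rewrite mulrC ler_pdivrMr ?mulr_gt0//; nra.
exact/eqyP.
Qed.

End GaussianIntegrals.

(** * Iterated Gaussian expectations of functionals of one or two coordinates *)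

Section GaussExp.
Context {R : realType}.
Local Notation gauss := (@normal_prob R 0 1).

Lemma integral_normal_prob_cst (c : \bar R) : (\int[gauss]_(a in [set: R]) c = c)%E.
Proof. by rewrite integral_cst//= /normal_prob integral_normal_pdf mule1. Qed.

Lemma gauss_exp_first N (h : R -> \bar R) : (0 < N)%N ->
  gauss_exp N (fun w => h (w 0%N)) = (\int[gauss]_a h a)%E.
Proof.
elim: N => // N IH _ /=; have [->//|N0] := posnP N.
under eq_integral do rewrite (ltn_eqF N0) IH//.
exact: integral_normal_prob_cst.
Qed.

(** The recursion integrates the highest coordinate outermost, hence [w j] outside and [w 0] inside;
    every other coordinate integrates a constant against a probability measure. *)
Lemma gauss_exp_pair N j (h : R -> R -> \bar R) : (0 < j < N)%N ->
  gauss_exp N (fun w => h (w 0%N) (w j)) =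
  (\int[gauss]_b \int[gauss]_a h a b)%E.
Proof.
elim: N => [|N IH] /andP[j0 jN]; first by [].
have N0 : (0 == N) = false by apply/negbTE; lia.
move: jN; rewrite ltnS leq_eqVlt => /predU1P[jN|jN] /=.
  subst j; rewrite N0 eqxx.
  by apply: eq_integral => b _; rewrite (gauss_exp_first _ (h^~ b)).
rewrite N0 (ltn_eqF jN); under eq_integral do rewrite IH ?j0//.
exact: integral_normal_prob_cst.
Qed.

End GaussExp.

(** * Pseudoinverse of a rank-one projector *)

Section Pseudoinverse.
Context {R : realType}.

(** For a unit vector, [K = v *m v^T] is an orthogonal projector fixing [v]. Inserting [K] on both
    sides of its pseudoinverse [P] and using [K *m P *m K = K] leaves [v^T *m v]. *)
Lemma penrose_rank_one_pinv n (v : 'cV[R]_n) : v^T *m v = 1%:M ->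
  v^T *m mp_pinv (v *m v^T) *m v = 1%:M.
Proof.
move=> vv; set K := v *m v^T.
have Kv : K *m v = v by rewrite -mulmxA vv mulmx1.
have KT : K^T = K by rewrite trmx_mul trmxK.
have vK : v^T *m K = v^T by rewrite -[in LHS]KT -trmx_mul Kv.
have KK : K *m K = K by rewrite [LHS]mulmxA Kv.
(* The projector is its own Penrose inverse, so [xget] does not fall back on its default 0. *)
have [+ _ _ _] : penrose K (mp_pinv K).
  by apply: (@xgetPex _ 0 [set B | penrose K B]); exists K; split; rewrite ?KK ?KT.
move: (mp_pinv K) => P KPK; clearbody K.
transitivity (v^T *m (K *m P *m K) *m v); last by rewrite KPK vK vv.
by rewrite !mulmxA vK -(mulmxA _ K v) Kv.
Qed.

End Pseudoinverse.

(** * One step of the sampled process *)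

Section Trajectory.
Context {R : realType} (nx nu nD : nat) (X : 'M[R]_(nx + nu, nD))
  (Y : 'M[R]_(nD, nx)) (sn2 : R) (k : 'cV[R]_(nx + nu) -> 'cV[R]_(nx + nu) -> R)
  (mu : 'cV[R]_(nx + nu) -> R) (u : nat -> 'cV[R]_nu)
  (mbar : memlen) (x0 : 'cV[R]_nx) (w : nat -> R).
Local Notation traj := (traj X Y sn2 k mu u mbar x0 w).
Local Notation state := (state X Y sn2 k mu u mbar x0 w).

Lemma size_traj t : size (traj t) = t.+1.
Proof. by elim: t => //= t IH; rewrite size_rcons IH. Qed.

Lemma nth_traj t s : (s <= t)%N -> nth x0 (traj t) s = state s.
Proof.
elim: t => [|t IH]; first by rewrite leqn0 => /eqP ->.
rewrite leq_eqVlt => /predU1P[->//|st] /=.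
by rewrite nth_rcons size_traj st IH.
Qed.

(** The step reads a finite history padded with [x0], which agrees with the process only up to time
    [t]; hence the existential form. *)
Lemma stateS t : exists2 xs, (forall s, (s <= t)%N -> xs s = state s) &
  state t.+1 = gp_mean X Y sn2 k mu u mbar t xs
    + Num.sqrt (gp_var X sn2 k u mbar t xs) *: \col_(i < nx) w (t * nx + i)%N.
Proof.
exists (fun s => nth x0 (traj t) s); first exact: nth_traj.
by rewrite /state /= nth_rcons size_traj ltnn eqxx.
Qed.

(** Conditioning on uncorrelated observations returns the prior mean, whatever the pseudoinverse
    is. *)
Lemma gp_mean_kvec0 t xs :
  kvec k (xi_of u xs t) (Xm X u mbar t xs) = 0 ->
  gp_mean X Y sn2 k mu u mbar t xs = const_mx (mu (xi_of u xs t)).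
Proof.
by move=> k0; apply/colP => i; rewrite mxE k0 trmx0 !mul0mx !mxE addr0.
Qed.

Lemma gp_var_kvec0 t xs :
  kvec k (xi_of u xs t) (Xm X u mbar t xs) = 0 ->
  gp_var X sn2 k u mbar t xs = k (xi_of u xs t) (xi_of u xs t).
Proof. by move=> k0; rewrite /gp_var k0 mulmx0 mxE subr0. Qed.

End Trajectory.

(** * Gaussian process regression with a rank-one kernel and no training data *)

Section RankOneKernel.
Context {R : realType} (nx nu : nat) (g : 'cV[R]_(nx + nu) -> R)
  (X : 'M[R]_(nx + nu, 0)) (Y : 'M[R]_(0, nx)) (sn2 : R)
  (mu : 'cV[R]_(nx + nu) -> R) (u : nat -> 'cV[R]_nu)
  (mbar : memlen) (t : nat) (xs : nat -> 'cV[R]_nx).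
Local Notation k := (fun a b => g a * g b).
Local Notation M := (mem_eff mbar t).
Local Notation v := (\col_i g (col i (Xm X u mbar t xs))).

Lemma psd_rank_one d (h : 'cV[R]_d -> R) : psd_kernel (fun a b => h a * h b).
Proof.
split=> [a b|N a c]; first by rewrite mulrC.
have -> : \sum_(i < N) \sum_(j < N) c i * c j * (h (a i) * h (a j)) =
    (\sum_(i < N) c i * h (a i)) ^+ 2.
  rewrite expr2 mulr_suml; apply: eq_bigr => i _; rewrite mulr_sumr.
  by apply: eq_bigr => j _; ring.
exact: sqr_ge0.
Qed.

Lemma col_Xm (j : 'I_M) :
  col (rshift 0 j) (Xm X u mbar t xs) = xi_of u xs (t - M + j)%N.
Proof. by apply/colP => i; rewrite mxE row_mxEr mxE. Qed.

(** Without training inputs the block carrying [sn2] is empty; only the noise-free Gram matrix of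
    the memory remains. *)
Lemma Km_rank_one : Km X sn2 k u mbar t xs = v *m v^T.
Proof.
apply/matrixP => i j.
case: (split_ordP i) => [[]//|{}i ->]; case: (split_ordP j) => [[]//|{}j ->].
rewrite block_mxEdr !mxE big_ord1 !mxE !col_Xm.
by congr (g _ * g _); apply/colP => r; rewrite !mxE.
Qed.

Lemma kvec_rank_one z : kvec k z (Xm X u mbar t xs) = g z *: v.
Proof. by apply/colP => i; rewrite !mxE. Qed.

Lemma kvec_rank_one_eq0 :
  (forall s, (t - M <= s < t)%N -> g (xi_of u xs t) * g (xi_of u xs s) = 0) ->
  kvec k (xi_of u xs t) (Xm X u mbar t xs) = 0.
Proof.
move=> gg; apply/colP => i; case: (split_ordP i) => [[]//|{}i ->].
rewrite mxE col_Xm gg ?mxE// leq_addr/=.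
have : (M <= t)%N by rewrite /mem_eff; case: (mbar) => // ?; exact: geq_minl.
by have := ltn_ord i; lia.
Qed.

(** The process is one random variable times [g]; a memory with unit gain vector determines that
    variable, so nothing random is left. *)
Lemma gp_var_rank_one : v^T *m v = 1%:M -> gp_var X sn2 k u mbar t xs = 0.
Proof.
move=> vv; rewrite /gp_var Km_rank_one kvec_rank_one -scalemxAr [(_ *: _)^T]linearZ/=.
by rewrite -!scalemxAl penrose_rank_one_pinv// !mxE mulr1 subrr.
Qed.

(** Here [c] is the value of the underlying variable with which all remembered residuals are
    consistent. *)
Lemma gp_mean_rank_one i c : v^T *m v = 1%:M ->
  (forall j : 'I_M, xs (t - M + j).+1 i 0 - mu (xi_of u xs (t - M + j)%N) =
     c * g (xi_of u xs (t - M + j)%N)) ->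
  gp_mean X Y sn2 k mu u mbar t xs i 0 =
  mu (xi_of u xs t) + g (xi_of u xs t) * c.
Proof.
move=> vv res; rewrite mxE; congr (_ + _).
have -> : col i (Ym Y mbar t xs) - mvec mu (Xm X u mbar t xs) = c *: v.
  apply/colP => j; case: (split_ordP j) => [[]//|{}j ->].
  by rewrite mxE [in LHS]mxE col_mxEd !mxE !col_Xm res.
rewrite Km_rank_one kvec_rank_one -scalemxAr [(_ *: _)^T]linearZ/= -!scalemxAl.
by rewrite penrose_rank_one_pinv// !mxE mulr1 mulrC.
Qed.

End RankOneKernel.

(** * The counterexample and its moments *)

Section Counterexample.
Context {R : realType} (m p : nat) (p_gt0 : (1 <= p)%N).
Local Notation gauss := (@normal_prob R 0 1).
Local Notation noX := (0 : 'M[R]_(1 + 1, 0)).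
Local Notation noY := (0 : 'M[R]_(0, 1)).

(* psi in the proof idea above *)
Definition root_weight (x : R) : R := cauchy_weight x `^ p%:R^-1.

Lemma root_weight_ge0 x : 0 <= root_weight x.
Proof. exact: powR_ge0. Qed.

Lemma root_weight_exprn x : root_weight x ^+ p = cauchy_weight x.
Proof.
rewrite -powR_mulrn ?root_weight_ge0// -powRrM mulVf ?powRr1 ?cauchy_weight_ge0//.
by rewrite pnatr_eq0 -lt0n.
Qed.

(** Kernel and mean see time only through the input, so the input serves as a clock. The value is
    also the multiplier in [prod_mean]: 1 copies the state, 0 erases it, and 2 is harmless at time 0
    because the initial state is 0. *)
Definition phase (t : nat) : nat :=
  if t == 0%N then 2 else if t == m.+1 then 0 else 1.

Definition phase_input (t : nat) : 'cV[R]_1 := const_mx (phase t)%:R.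

Definition gain (z : 'cV[R]_(1 + 1)) : R :=
  if dsubmx z 0 0 == 2 then 1
  else if dsubmx z 0 0 == 0 then root_weight (usubmx z 0 0) else 0.

(** A product instead of a case distinction on the phase, so that the mean is continuous. *)
Definition prod_mean (z : 'cV[R]_(1 + 1)) : R := usubmx z 0 0 * dsubmx z 0 0.

Local Notation ker := (fun a b => gain a * gain b).
Local Notation xi := (xi_of phase_input).

Lemma prod_mean_xi xs t : prod_mean (xi xs t) = xs t 0 0 * (phase t)%:R.
Proof. by rewrite /prod_mean col_mxKu col_mxKd mxE. Qed.

Lemma gain_xi xs t : gain (xi xs t) =
  if t == 0%N then 1 else if t == m.+1 then root_weight (xs t 0 0) else 0.
Proof.
rewrite /gain col_mxKu col_mxKd mxE /phase.
case: (t == 0%N); first by rewrite eqxx.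
case: (t == m.+1); first by rewrite (eqr_nat R 0 2) eqxx.
by rewrite (eqr_nat R 1 2) oner_eq0.
Qed.

Lemma continuous_prod_mean : continuous prod_mean.
Proof.
move=> z; have -> : prod_mean = (fun y => y (lshift 1 0) 0 * y (rshift 1 0) 0).
  by apply/funext => y; rewrite /prod_mean !mxE.
by apply: (@continuousM R 'M[R]_(1 + 1, 1)); exact: coord_continuous.
Qed.

Local Notation st := (state noX noY 1 ker prod_mean phase_input).

(** Only times 0 and [m.+1] can have nonzero gain. Unless time 0 is still remembered at time [m.+1],
    the current point is uncorrelated with its memory, and the step is a draw from the prior. *)
Lemma state_uncorrelated mbar w t :
  (t = m.+1 -> (mem_eff mbar t <= m)%N) ->
  st mbar 0 w t.+1 0 0 = st mbar 0 w t 0 0 * (phase t)%:R +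
    (if t == 0%N then 1
     else if t == m.+1 then root_weight (st mbar 0 w t 0 0) else 0) * w t.
Proof.
move=> short; have [xs xsE ->] := stateS _ _ _ noX noY 1 ker
  prod_mean phase_input mbar 0 w t.
have k0 : kvec ker (xi xs t) (Xm noX phase_input mbar t xs) = 0.
  apply: kvec_rank_one_eq0 => s /andP[ts st]; rewrite !gain_xi.
  case: eqP => [t0|_]; first lia.
  case: eqP => [tm|_]; last by rewrite mul0r.
  (* A memory of length at most [m] at time [m.+1] starts at time 1 or later, which excludes
     [s = 0]. *)
  have := short tm; case: eqP => [|_ _]; first lia.
  by case: eqP => [|_]; [lia|rewrite mulr0].
rewrite gp_mean_kvec0// gp_var_kvec0// -expr2 sqrtr_sqr prod_mean_xi xsE//.
rewrite !mxE muln1 addn0 gain_xi xsE// ger0_norm//.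
by case: ifP => // _; case: ifP => // _; exact: root_weight_ge0.
Qed.

Lemma state_holds_first_noise mbar w t : (t <= m)%N ->
  st mbar 0 w t.+1 0 0 = w 0%N.
Proof.
elim: t => [_|t IH tm]; rewrite state_uncorrelated /phase/=; try lia.
  by rewrite mxE mul0r add0r mul1r.
by rewrite IH 1?ltnW// eqSS ltn_eqF// mulr1 mul0r addr0.
Qed.

Lemma state_short w t : (m.+1 < t)%N ->
  st (Some m) 0 w t 0 0 = root_weight (w 0%N) * w m.+1.
Proof.
elim: t => // t IH; rewrite ltnS leq_eqVlt => /predU1P[<-|mt].
  rewrite state_uncorrelated; last by move=> _; exact: geq_minr.
  by rewrite state_holds_first_noise// /phase/= eqxx mulr0 add0r.
rewrite state_uncorrelated; last by move=> _; exact: geq_minr.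
rewrite IH// /phase (gtn_eqF mt) gtn_eqF ?(leq_ltn_trans _ mt)//.
by rewrite mulr1 mul0r addr0.
Qed.

(** The remembered gains are 1 at time 0 and 0 at times 1 to [m], so the gain vector is a basis
    vector; the regression recovers [w 0] exactly and has zero variance. *)
Lemma state_long mbar w : mem_eff mbar m.+1 = m.+1 ->
  st mbar 0 w m.+2 0 0 = root_weight (w 0%N) * w 0%N.
Proof.
move=> long; have [xs xsE ->] := stateS _ _ _ noX noY 1 ker
  prod_mean phase_input mbar 0 w m.+1.
have d0 : (m.+1 - mem_eff mbar m.+1 = 0)%N by rewrite long subnn.
have first s : (s <= m)%N -> xs s.+1 0 0 = w 0%N.
  by move=> sm; rewrite xsE// state_holds_first_noise.
have xs0 : xs 0%N 0 0 = 0 by rewrite xsE// mxE.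
set v := \col_i gain (col i (Xm noX phase_input mbar m.+1 xs)).
have vE j : v (rshift 0 j) 0 = (j == 0%N :> nat)%:R.
  rewrite mxE col_Xm gain_xi d0 add0n.
  have jm : (j < m.+1)%N by have := ltn_ord j; rewrite [X in (_ < X)%N]long.
  by case: (nat_of_ord j) jm => [|i] im //=; rewrite ltn_eqF.
have vv : v^T *m v = 1%:M.
  apply/matrixP => i j; rewrite !ord1 !mxE eqxx.
  have M0 : (0 < mem_eff mbar m.+1)%N by rewrite long.
  rewrite (bigD1 (rshift 0 (Ordinal M0)))//= big1 => [|l].
    by rewrite mxE vE eqxx mul1r addr0.
  case: (split_ordP l) => [[]//|{}l ->] ln0.
  rewrite mxE vE; case: eqP => [l0|_]; last by rewrite mul0r.
  by case/eqP: ln0; congr (rshift _ _); exact: val_inj.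
rewrite gp_var_rank_one// sqrtr0 scale0r addr0.
rewrite (gp_mean_rank_one _ _ _ _ _ _ _ _ _ _ _ _ (w 0%N))//; last first.
  (* The residual is [w 0] at time 0, where the prior mean vanishes, and 0 at the later times, where
     the state was copied. *)
  move=> j; have jm : (j < m.+1)%N by have := ltn_ord j; rewrite [X in (_ < X)%N]long.
  rewrite prod_mean_xi gain_xi d0 add0n /phase first//.
  case: (nat_of_ord j) jm => [|i] im /=; first by rewrite xs0 mul0r subr0 mulr1.
  by rewrite first 1?ltnW// ltn_eqF// mulr1 subrr mulr0.
by rewrite prod_mean_xi gain_xi /phase/= eqxx mulr0 add0r first.
Qed.

Lemma eucl_norm1 (v : 'cV[R]_1) : eucl_norm v = `|v 0 0|.
Proof. by rewrite /eucl_norm big_ord1 sqrtr_sqr. Qed.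

Local Notation mom mbar := (moment noX noY 1 ker prod_mean phase_input mbar 0 p).

Lemma moment_initial mbar : mom mbar 0%N = 0%E.
Proof.
by rewrite /moment mul0n /= eucl_norm1 mxE normr0 expr0n gtn_eqF.
Qed.

Lemma moment_hold mbar t : (t <= m)%N ->
  mom mbar t.+1 = (\int[gauss]_x (`|x| ^+ p)%:E)%E.
Proof.
move=> tm; rewrite /moment muln1 -(gauss_exp_first t.+1)//; congr gauss_exp.
by apply/funext => w; rewrite eucl_norm1 state_holds_first_noise.
Qed.

Lemma moment_short t : (m.+1 < t)%N ->
  mom (Some m) t = ((\int[gauss]_x (`|x| ^+ p)%:E) *
                    (\int[gauss]_x (cauchy_weight x)%:E))%E.
Proof.
move=> mt; rewrite /moment muln1.
(* Here [b] stands for [w m.+1] and [a] for [w 0]; their independence makes the moment a product. *)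
transitivity (\int[gauss]_b \int[gauss]_a
    ((`|b| ^+ p)%:E * (cauchy_weight a)%:E))%E.
  rewrite -(gauss_exp_pair t m.+1)//; congr gauss_exp; apply/funext => w.
  rewrite eucl_norm1 state_short// normrM exprMn ger0_norm ?root_weight_ge0//.
  by rewrite root_weight_exprn mulrC.
have mw : measurable_fun [set: R] (fun x => (cauchy_weight x)%:E).
  by apply/measurable_EFinP; exact: measurable_cauchy_weight.
have w0 x : (0 <= (cauchy_weight x)%:E)%E by rewrite lee_fin cauchy_weight_ge0.
under eq_integral do rewrite ge0_integralZl_EFin//.
rewrite ge0_integralZr//.
  apply/measurable_EFinP; apply: measurable_funX; exact: normr_measurable.
by apply: integral_ge0.
Qed.

Lemma moment_long mbar : mem_eff mbar m.+1 = m.+1 -> mom mbar m.+2 = +oo%E.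
Proof.
move=> long; rewrite /moment muln1 -(integral_cauchy_weight_moment p p_gt0).
rewrite -(gauss_exp_first m.+2)//; congr gauss_exp; apply/funext => w.
rewrite eucl_norm1 state_long// normrM exprMn ger0_norm ?root_weight_ge0//.
by rewrite root_weight_exprn.
Qed.

Lemma moments_bounded_short :
  moments_bounded noX noY 1 ker prod_mean phase_input (Some m) 0 p.
Proof.
rewrite /moments_bounded; set E1 := (\int[gauss]_x (`|x| ^+ p)%:E)%E.
set E2 := (\int[gauss]_x (cauchy_weight x)%:E)%E.
have E10 : (0 <= E1)%E by apply: integral_ge0 => x _; rewrite lee_fin exprn_ge0.
have E20 : (0 <= E2)%E.
  by apply: integral_ge0 => x _; rewrite lee_fin cauchy_weight_ge0.
have E12 : (0 <= E1 * E2)%E by exact: mule_ge0.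
(* The moments take only the values 0, [E1] and [E1 * E2], all below this sum. *)
apply: (@le_lt_trans _ _ (E1 + E1 * E2)%E); last first.
  rewrite lte_add_pinfty ?lte_mul_pinfty ?normal_abs_moment_lty//.
    by rewrite ge0_fin_numE ?normal_abs_moment_lty.
  exact: integral_cauchy_weight_lty.
apply: ub_ereal_sup => _ [[|t] _ <-]; first by rewrite moment_initial adde_ge0.
have [tm|mt] := leqP t m; first by rewrite moment_hold// leeDl.
by rewrite moment_short// leeDr.
Qed.

Lemma moments_unbounded_long mbar : mem_eff mbar m.+1 = m.+1 ->
  ~ moments_bounded noX noY 1 ker prod_mean phase_input mbar 0 p.
Proof.
move=> long; rewrite /moments_bounded.
suff -> : ereal_sup (range (mom mbar)) = +oo%E by rewrite ltxx.
apply/eqP; rewrite -leye_eq -(moment_long _ long).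
by apply: ereal_sup_ubound; exists m.+2.
Qed.

End Counterexample.

Theorem theorem2 (R : realType) (mbar mbar' : memlen) (p : nat) :
  mem_lt mbar mbar' -> (1 <= p)%N ->
  exists (nx nu nD : nat) (X : 'M[R]_(nx + nu, nD)) (Y : 'M[R]_(nD, nx))
         (sn2 : R) (k : 'cV[R]_(nx + nu) -> 'cV[R]_(nx + nu) -> R)
         (mu : 'cV[R]_(nx + nu) -> R) (u : nat -> 'cV[R]_nu) (x0 : 'cV[R]_nx),
    [/\ 0 < sn2, psd_kernel k, continuous mu,
        moments_bounded X Y sn2 k mu u mbar x0 p &
        ~ moments_bounded X Y sn2 k mu u mbar' x0 p].
Proof.
case: mbar => // m lt_mm' p_gt0.
(* A memory longer than [m], finite or not, still reaches back to time 0 at time [m.+1]. *)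
have long : mem_eff mbar' m.+1 = m.+1.
  by case: mbar' lt_mm' => //= m' /minn_idPl.
exists 1%N, 1%N, 0%N, 0, 0, 1, (fun a b => gain p a * gain p b), prod_mean,
  (phase_input m), 0; split.
- exact: ltr01.
- exact: psd_rank_one.
- exact: continuous_prod_mean.
- exact: moments_bounded_short.
- exact: moments_unbounded_long.
Qed.
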